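(* The set of prime numbers, as a subset of $\mathbb{R}$, is not MICP-R.
   Context: Let $n\in\mathbb{N}=\{1,2,\dots\}$ and $p,d\in\mathbb{Z}_+=\{0,1,2,\dots\}$. A closed convex set $M\subseteq\mathbb{R}^{n+p+d}$ (with $d$) induces an MICP formulation of $S\subseteq\mathbb{R}^n$ if for every $x\in\mathbb{R}^n$: $x\in S$ if and only if there exist $y\in\mathbb{R}^p$, $z\in\mathbb{Z}^d$ with $(x,y,z)\in M$. The set $S$ is MICP-R (MICP representable) if such $p,d,M$ exist. *)

(* Defs.v *)
From HB Require Import structures.
From mathcomp Require Import all_boot all_order all_algebra.
From mathcomp Require Import all_classical all_reals all_analysis.

Set Implicit Arguments.
Unset Strict Implicit.
Unset Printing Implicit Defensive.

Import Order.TTheory GRing.Theory Num.Theory.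
Import numFieldNormedType.Exports.

Local Open Scope classical_set_scope.
Local Open Scope ring_scope.

(* Points of R^(n+p+d) are row vectors (x, y, z), the last block being the
   image in R^d of an integer vector. *)
Definition MICP_formulation (R : realType) (n p d : nat)
    (M : set 'rV[R]_(n + p + d)) (S : set 'rV[R]_n) : Prop :=
  forall x : 'rV[R]_n, S x <->
    exists (y : 'rV[R]_p) (z : 'rV[int]_d),
      M (row_mx (row_mx x y) (map_mx intr z)).

Definition MICP_R (R : realType) (n : nat) (S : set 'rV[R]_n) : Prop :=
  exists (p d : nat) (M : set 'rV[R]_(n + p + d)),
    [/\ closed M, convex_set M & MICP_formulation M S].

(* The real line is R^1, i.e. 'rV[R]_1. *)
Definition primes_set (R : realType) : set 'rV[R]_1 :=
  [set x | exists2 q : nat, prime q & x = const_mx q%:R].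
Arguments primes_set : clear implicits.

(* Main.v *)
Require Import Defs.
From mathcomp Require Import all_boot all_order all_algebra.
From mathcomp Require Import all_classical all_reals all_analysis.
From mathcomp Require Import zify.

(** Suppose that a convex set M with d integer coordinates represents the set of
    primes, and attach to every prime a representing point of M.  Fix m > 0 and
    colour each prime by its integer coordinates modulo m, which uses at most
    m ^ d colours.  If two primes q < r have the same colour, the m + 1 equally
    spaced points of the chord between their representatives all have integral
    last coordinates ([MICP_lattice_chord]), so q, q + D, ..., q + m D = r is an
    arithmetic progression of primes ([prime_chord_AP]).  When q > m, such a
    progression has a common difference divisible by every prime l <= m:
    otherwise its first l terms would cover all residues modulo l, and one of
    them would be a multiple of l larger than l ([prime_AP_dvd]).  Hence r - q
    is at least the primorial of m, which is at least 2 ^ pi(m).  So primes in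
    the interval from m + 1 to 2 ^ pi(m) have pairwise distinct colours, and
    there are at most m ^ d of them.

    This is absurd for large m, since 2 ^ pi(m) grows faster than any power of m
    and a positive power of it bounds the number of primes below it.  A bound of
    Chebyshev type is enough: a prime power exactly dividing 'C(2n, n) is at most
    2n, whence 2 ^ n <= 'C(2n, n) <= (2n) ^ pi(2n).  It is used twice, at m and
    at 2 ^ pi(m) ([primepi_superpoly]). *)

Set Implicit Arguments.
Unset Strict Implicit.
Unset Printing Implicit Defensive.

Import Order.TTheory GRing.Theory Num.Theory.

(** * A lower bound of Chebyshev type for the number of primes *)

Definition primepi n := #|[pred p : 'I_n.+1 | prime p]|.

Definition primorial n := \prod_(p < n.+1 | prime p) p.

(** By Legendre's formula the exponent of [p] in 'C(n, m) is the sum over [i] of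
    n / p^i - m / p^i - (n - m) / p^i (integer quotients).  Each term is at most
    1, and it vanishes once p^i > n. *)
Lemma logn_bin_le p n m : prime p -> m <= n -> 0 < n ->
  p ^ logn p 'C(n, m) <= n.
Proof.
move=> p_pr le_mn n_gt0; have p_gt1 := prime_gt1 p_pr.
apply: leq_trans (trunc_logP p_gt1 n_gt0); rewrite leq_exp2l //.
set L := trunc_log p n.
(* A common range of summation for the three factorials. *)
have widen_fact k : k <= n -> logn p k`! = \sum_(1 <= i < n.+1) k %/ p ^ i.
  move=> le_kn; rewrite logn_fact // [RHS](big_cat_nat (n := k.+1)) //=.
  rewrite [X in _ + X]big_nat_cond [X in _ + X]big1 ?addn0 // => i.
  rewrite andbT => /andP[lt_ki _]; apply: divn_small.
  by apply: leq_trans (ltn_expl i p_gt1); apply: ltnW.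
have logE : logn p 'C(n, m) + (logn p m`! + logn p (n - m)`!) = logn p n`!.
  by rewrite -lognM ?fact_gt0 // -lognM ?bin_gt0 ?muln_gt0 ?fact_gt0 // bin_fact.
rewrite -(leq_add2r (logn p m`! + logn p (n - m)`!)) logE.
rewrite !widen_fact ?leq_subr // -!big_split /=.
have -> : L = \sum_(1 <= i < n.+1) (i <= L).
  have le_Ln : L < n.+1.
    rewrite ltnS; apply: leq_trans (ltnW (ltn_expl L p_gt1)) _.
    exact: trunc_logP.
  rewrite (big_cat_nat (n := L.+1)) //= big_nat_cond.
  rewrite (eq_bigr (fun=> 1)) => [|i /andP[/andP[_ ?] _]]; last lia.
  rewrite -big_nat_cond sum_nat_const_nat big_nat_cond.
  rewrite big1 => [|i /andP[/andP[? _] _]]; lia.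
rewrite -big_split /=; apply: leq_sum => i _.
case: (leqP i L) => [_|lt_Li].
  by have := leq_divDl (p ^ i) m (n - m); rewrite subnKC //; lia.
rewrite divn_small // ltnNge; apply/negP => /(trunc_log_max p_gt1).
by rewrite leqNgt lt_Li.
Qed.

Lemma leq_bin_primepi n m : m <= n -> 0 < n -> 'C(n, m) <= n ^ primepi n.
Proof.
move=> le_mn n_gt0; have C_gt0 : 0 < 'C(n, m) by rewrite bin_gt0.
(* The binomial may be smaller than n, hence a bound on primes above both. *)
rewrite -(partnT C_gt0) (@widen_partn ('C(n, m) + n)) ?leq_addr //.
rewrite (big_cat_nat (n := n.+1)) ?ltnS ?leq_addl //=.
rewrite [X in _ * X]big_nat_cond [X in _ * X]big1 ?muln1; last first.
  move=> p /andP[/andP[lt_np _] _].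
  case p_pr: (prime p); last by rewrite lognE p_pr.
  have := logn_bin_le p_pr le_mn n_gt0.
  case: (logn p _) => // e; rewrite expnS => le_pn.
  have : p <= n by apply: leq_trans le_pn; rewrite leq_pmulr // expn_gt0 prime_gt0.
  by rewrite leqNgt lt_np.
rewrite big_mkord /primepi -prod_nat_const.
rewrite [X in _ <= X]big_mkcond; apply: leq_prod => p _ /=.
rewrite inE; case p_pr: (prime p); first exact: logn_bin_le.
by rewrite lognE p_pr.
Qed.

Lemma expn2_le_bin n : 2 ^ n <= 'C(n.*2, n).
Proof.
elim: n => [|n IHn] //; rewrite doubleS binS expnS mul2n -addnn leq_add //.
  by rewrite binS (leq_trans IHn) // leq_addl.
case: n IHn => [|n] IHn //.
by rewrite binS (leq_trans IHn) // leq_addr.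
Qed.

(** Chebyshev's bound at powers of two, where log2 of the argument is exact. *)
Lemma primepi_expn2 k : 2 ^ k <= k.+1 * primepi (2 ^ k.+1).
Proof.
rewrite -(leq_exp2l (m := 2)) // expnM.
have -> : 2 ^ k.+1 = (2 ^ k).*2 by rewrite expnS mul2n.
apply: leq_trans (expn2_le_bin _) _.
apply: leq_bin_primepi; first by rewrite -addnn leq_addr.
by rewrite double_gt0 expn_gt0.
Qed.

(** * Arithmetic progressions of primes *)

Lemma primorial_ge n : 2 ^ primepi n <= primorial n.
Proof.
by rewrite /primepi -prod_nat_const; apply: leq_prod => p; apply: prime_gt1.
Qed.

Lemma primorial_dvd n D :
  (forall l, prime l -> l <= n -> l %| D) -> primorial n %| D.
Proof.
rewrite /primorial -(big_mkord prime id) => dvdD.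
suff: forall k, k <= n.+1 -> \prod_(0 <= p < k | prime p) p %| D by apply.
elim=> [|k IHk] le_kn; first by rewrite big_geq // dvd1n.
rewrite big_mkcond big_nat_recr //= -big_mkcond /=.
case: ifP => k_pr; last by rewrite muln1 IHk // ltnW.
rewrite Gauss_dvd ?IHk 1?ltnW ?dvdD //.
rewrite coprime_sym big_nat_cond; apply: (big_ind (coprime k)) => [|x y cx cy|p].
- exact: coprimen1.
- by rewrite coprimeMr cx.
case/andP=> /andP[_ lt_pk] p_pr.
rewrite prime_coprime // dvdn_prime2 //; apply/negP => /eqP; lia.
Qed.

(** If [D] were invertible modulo [l], some [j < l] would make [p + j * D] a
    multiple of [l]; being prime, it would equal [l], but it is at least
    [p > l]. *)
Lemma prime_AP_dvd p D m l : prime l -> l <= m -> m < p ->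
  (forall j, j <= m -> prime (p + j * D)) -> l %| D.
Proof.
move=> l_pr le_lm lt_mp primeAP; apply/negPn/negP => ndvd.
have l_gt0 := prime_gt0 l_pr.
have cop : coprime l D by rewrite prime_coprime.
have D_gt0 : 0 < D by case: D ndvd {primeAP cop}; rewrite ?dvdn0.
case: (egcdnP l D_gt0) => u v uDv _.
rewrite (eqP (_ : gcdn D l == 1)) in uDv; last by rewrite -/(coprime D l) coprime_sym.
(* u inverts D modulo l and l.-1 stands for -1, so j is - p / D modulo l. *)
pose j := (p * u * l.-1) %% l.
have lt_jl : j < l by rewrite ltn_mod.
have dvd_j : l %| p + j * D.
  rewrite /dvdn -modnDmr modnMml modnDmr -/(dvdn _ _).
  have -> : p + p * u * l.-1 * D = l * (p * (1 + l.-1 * v)).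
    rewrite -mulnA (mulnC l.-1) -!mulnA (mulnA u) uDv.
    by case: (l) l_gt0 => // l1 _ /=; lia.
  exact: dvdn_mulr.
have := primeAP j (leq_trans (ltnW lt_jl) le_lm).
move/(dvdn_prime2 l_pr) => E; rewrite E in dvd_j; lia.
Qed.

Lemma prime_AP_gap p D m : m < p -> 0 < D ->
  (forall j, j <= m -> prime (p + j * D)) -> 2 ^ primepi m <= D.
Proof.
move=> lt_mp D_gt0 primeAP; apply: leq_trans (primorial_ge m) (dvdn_leq D_gt0 _).
apply: primorial_dvd => l l_pr le_lm; exact: prime_AP_dvd primeAP.
Qed.

(** * Comparing the number of primes with the number of colours *)

Lemma cubic_lt_expn4 c : 5 <= c -> c * c.*2.+1 ^ 2 < 2 ^ c.*2.
Proof.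
elim: c => // c IHc; rewrite leq_eqVlt => /predU1P[<- //|]; rewrite ltnS => le5c.
have {}IHc := IHc le5c; rewrite doubleS !expnS in IHc *; nia.
Qed.

(** The right-hand side counts the primes up to 2 ^ pi(m); at most [m] of them are
    at most [m], so more than [m ^ d] lie above [m].  For m = 2 ^ k and
    t = pi(m), Chebyshev's bound gives t >= 2 ^ k.-1 / k and then
    pi(2 ^ t) >= 2 ^ t.-1 / t.  As t <= 2 ^ k.+1, a failure of the inequality
    would make t linear in k. *)
Lemma primepi_superpoly d : exists m, 0 < m /\
  m + m ^ d < primepi (2 ^ primepi m).
Proof.
(* The factor d + 5 absorbs the constants of t <= k * (d + 2) + 3 <= c * k. *)
pose c := d + 5; pose k := c.*2.+1.
exists (2 ^ k); split; first by rewrite expn_gt0.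
set t := primepi (2 ^ k); have k_t : 2 ^ c.*2 <= k * t := primepi_expn2 _.
have le_t : t <= 2 ^ k.+1.
  rewrite (leq_trans (max_card _)) // card_ord expnS mul2n -addnn -addn1.
  by rewrite leq_add2l expn_gt0.
have large : k * (c * k) < k * t.
  apply: leq_trans k_t; have := @cubic_lt_expn4 c (leq_addl _ _).
  by rewrite -/k mulnA (mulnC k) -mulnA mulnn.
rewrite ltn_pmul2l // in large.
case: t le_t large {k_t} => // u le_u large.
rewrite ltnNge; apply/negP => le_pi.
have : 2 ^ u <= 2 ^ (k.+1 + (k * d.+1).+1).
  apply: leq_trans (primepi_expn2 u) _; rewrite expnD leq_mul //.
  apply: leq_trans le_pi _; rewrite expnS mul2n -addnn expnM.
  rewrite leq_add // expnS; first by rewrite leq_pmulr // !expn_gt0.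
  by rewrite leq_pmull // expn_gt0.
rewrite leq_exp2l // /c in large *; rewrite /k /c; nia.
Qed.
(** * Lattice points on chords of a convex set *)

Local Open Scope ring_scope.

(** Dividing a chord of [M] into [m] equal parts keeps the last block of
    coordinates integral as soon as its two end values agree modulo [m], so
    every division point projects into [S]. *)
Lemma MICP_lattice_chord (R : realType) (n p d : nat)
    (M : set 'rV[R]_(n + p + d)) (S : set 'rV[R]_n) (m j : nat)
    (x x' : 'rV[R]_n) (y y' : 'rV[R]_p) (z z' : 'rV[int]_d) :
    convex_set M -> MICP_formulation M S ->
    M (row_mx (row_mx x y) (map_mx intr z)) ->
    M (row_mx (row_mx x' y') (map_mx intr z')) ->
    (0 < m)%N -> (j <= m)%N ->
    (forall i, (z 0%R i = z' 0%R i %[mod m%:Z])%Z) ->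
  S (x + (j%:R / m%:R) *: (x' - x)).
Proof.
move=> convM formM Mz Mz' m_gt0 le_jm eq_mod; apply/formM.
pose l : R := j%:R / m%:R.
have m_neq0 : m%:R != 0 :> R by rewrite pnatr_eq0 -lt0n.
have l_ge0 : 0 <= l by rewrite divr_ge0.
have l_le1 : l <= 1 by rewrite ler_pdivrMr ?ltr0n // mul1r ler_nat.
pose w := \row_i (z 0 i + (((z' 0 i - z 0 i)%R %/ m%:Z)%Z) * j%:Z).
(* The congruence makes the increment of w exactly l times that of z. *)
exists (y + l *: (y' - y)), w.
have wE : map_mx intr w = map_mx intr z + l *: (map_mx intr z' - map_mx intr z)
    :> 'rV[R]_d.
  apply/rowP => i; rewrite !mxE.
  have dvd_m : (m%:Z %| (z' 0 i - z 0 i)%R)%Z.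
    by rewrite -eqz_mod_dvd; apply/eqP.
  have := divzK dvd_m; set q := (_ %/ _)%Z => qE.
  rewrite rmorphD rmorphM /= -rmorphB /= -qE rmorphM /= /l.
  by rewrite mulrCA -!pmulrn divfK.
have /set_mem := convM _ _ (Itv01 l_ge0 l_le1) (mem_set Mz') (mem_set Mz).
congr M; rewrite /conv /= wE.
transitivity (l *: row_mx (row_mx x' y') (map_mx intr z') +
   (1 - l) *: row_mx (row_mx x y) (map_mx intr z)); first by [].
have chordE k (u u' : 'rV[R]_k) : u + l *: (u' - u) = l *: u' + (1 - l) *: u.
  by rewrite scalerBr scalerBl scale1r addrCA.
by rewrite !chordE !scale_row_mx !add_row_mx.
Qed.

(** The point with [j = 1] is a prime, hence an integer, and this is what makes
    the common difference (b - a) / m integral. *)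
Lemma prime_chord_AP (R : realType) (m a b : nat) :
    (0 < m)%N -> (a < b)%N ->
    (forall j, (j <= m)%N -> primes_set R
       (const_mx a%:R + (j%:R / m%:R) *: (const_mx b%:R - const_mx a%:R))) ->
  exists2 D, (b = a + m * D)%N & forall j, (j <= m)%N -> prime (a + j * D).
Proof.
move=> m_gt0 lt_ab chordP.
have m_neq0 : m%:R != 0 :> R by rewrite pnatr_eq0 -lt0n.
have chord_prime j : (j <= m)%N ->
    exists2 q, prime q & (m * q = m * a + j * (b - a))%N.
  move=> /chordP[q q_pr /rowP/(_ 0)]; rewrite !mxE => qE; exists q => //.
  apply/eqP; rewrite -(eqr_nat R) natrD !natrM -qE mulrDr natrB 1?ltnW //.
  by rewrite mulrA (mulrCA m%:R) divff ?mulr1.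
have [q _ qE] := chord_prime 1%N m_gt0.
exists (q - a)%N => [|j /chord_prime[r r_pr rE]]; first by nia.
suff <- : r = (a + j * (q - a))%N by [].
apply/eqP; rewrite -(eqn_pmul2l m_gt0); apply/eqP; nia.
Qed.

Theorem proposition4p4 (R : realType) : ~ MICP_R (primes_set R).
Proof.
move=> [p [d [M [_ convM formM]]]].
have [m [m_gt0 many]] := primepi_superpoly d.
(* N is generalized to keep the power of two from being evaluated. *)
move NE : (2 ^ primepi m)%N many => N many.
have /choice[f fP] (q : nat) : exists yz : 'rV[R]_p * 'rV[int]_d, prime q ->
    M (row_mx (row_mx (const_mx q%:R) yz.1) (map_mx intr yz.2)).
  case q_pr: (prime q); last by exists (0, 0).
  have /formM[y [z Myz]] : primes_set R (const_mx q%:R) by exists q.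
  by exists (y, z).
pose A := [pred q : 'I_N.+1 | prime q].
pose small := [pred q : 'I_N.+1 | (q <= m)%N].
(* Primes are positive, so q |-> q - 1 embeds those up to m into m values. *)
have card_small : (#|[predI A & small]| <= m)%N.
  rewrite -[leqRHS]card_ord -(prednK m_gt0).
  apply: (@leq_card_in _ _ (fun q : 'I_N.+1 => inord q.-1 : 'I_m.-1.+1)).
  move=> q r /andP[q_pr le_qm] /andP[r_pr le_rm] /(congr1 val).
  have := prime_gt0 q_pr; have := prime_gt0 r_pr; rewrite !inE in le_qm le_rm.
  by rewrite /= !inordK => *; try apply: val_inj; rewrite /=; lia.
pose color (q : 'I_N.+1) : {ffun 'I_d -> 'I_m.-1.+1} :=
  [ffun i => inord `|((f q).2 0%R i %% m%:Z)%Z|].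
have color_mod q r i : color q = color r ->
    ((f q).2 0%R i = (f r).2 0%R i %[mod m%:Z])%Z.
  have m_neq0 : m%:Z != 0 by rewrite -lt0n.
  move/ffunP/(_ i)/(congr1 val); rewrite !ffunE /=.
  have bound x : (`|(x %% m%:Z)%Z| < m.-1.+1)%N.
    by rewrite prednK // -ltz_nat gez0_abs ?modz_ge0 // ltz_pmod.
  rewrite !inordK ?bound // => /(congr1 Posz).
  by rewrite !gez0_abs ?modz_ge0.
have no_pair (q r : 'I_N.+1) : prime q -> prime r -> (m < q)%N ->
    color q = color r -> ~~ (q < r)%N.
  move=> q_pr r_pr lt_mq eq_col; apply/negP => lt_qr.
  have [j le_jm|D rE AP] := @prime_chord_AP R m q r m_gt0 lt_qr.
    apply: (MICP_lattice_chord convM formM (fP _ q_pr) (fP _ r_pr)) => // i.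
    exact: color_mod.
  have D_gt0 : (0 < D)%N by case: D rE {AP} => //; lia.
  have le_ND : (N <= D)%N by rewrite -NE; apply: prime_AP_gap AP.
  have := ltn_ord r; rewrite rE ltnS leqNgt => /negP; apply.
  by have := leq_pmull D m_gt0; lia.
have card_large : (#|[predD A & small]| <= m ^ d)%N.
  rewrite -[X in (_ <= X ^ _)%N](prednK m_gt0) -[X in (_ <= X ^ _)%N]card_ord.
  rewrite -[X in (_ <= _ ^ X)%N]card_ord -card_ffun.
  apply: (@leq_card_in _ _ color) => q r.
  rewrite !inE -!ltnNge => /andP[lt_mq q_pr] /andP[lt_mr r_pr] eq_col.
  case: (ltngtP q r) => [lt_qr|lt_rq|/val_inj //].
  - by have := no_pair q r q_pr r_pr lt_mq eq_col; rewrite lt_qr.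
  - by have := no_pair r q r_pr q_pr lt_mr (esym eq_col); rewrite lt_rq.
move: many; rewrite /primepi -/A -(cardID small A); apply/negP; rewrite -leqNgt.
exact: leq_add.
Qed.
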